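(* The extended tropical semiring $\mathbb{T}$ is algebraically closed in the tropical sense: every nonconstant tropical polynomial $f \in \mathbb{T}[x_1,\dots,x_n]$ has a root, i.e. there exists $\mathbf{a}\in\mathbb{T}^{(n)}$ with $f(\mathbf{a})\in\bar{\mathbb{U}}$.
   Context: Extended tropical semiring: $\mathbb{T}=\mathbb{R}\cup\{-\infty\}\cup\mathbb{R}^\nu$, where $\mathbb{R}^\nu=\{a^\nu : a\in\mathbb{R}\}$ is a disjoint copy of $\mathbb{R}$. Elements of $\mathbb{R}$ are tangible, elements of $\mathbb{U}=\mathbb{R}^\nu$ are ghost, and $\bar{\mathbb{U}}=\mathbb{U}\cup\{-\infty\}$. Put $(a^\nu)^\nu=a^\nu$ and $(-\infty)^\nu=-\infty$. Total order: $-\infty$ is the least element; for reals $a<b$ each of $a,a^\nu$ is $\prec$ each of $b,b^\nu$; and $a\prec a^\nu$. Addition: $\alpha\oplus\beta=\max_{\prec}\{\alpha,\beta\}$ if $\alpha\ne\beta$, and $\alpha\oplus\alpha=\alpha^\nu$ (so $(-\infty)\oplus(-\infty)=-\infty$). Multiplication (written $\odot$ or by juxtaposition): $a\odot b=a+b$, $a^\nu\odot b=a\odot b^\nu=a^\nu\odot b^\nu=(a+b)^\nu$ for $a,b\in\mathbb{R}$, and $-\infty$ is absorbing. This is a commutative semiring with zero $-\infty$ and unit $0$. $\mathbb{T}^{(n)}$ is the $n$-fold Cartesian product. $\mathbb{T}[x_1,\dots,x_n]$ is the semiring of formal polynomials $\bigoplus_{\mathbf{i}}\alpha_{\mathbf{i}}x_1^{i_1}\cdots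 x_n^{i_n}$ (almost all $\alpha_{\mathbf{i}}=-\infty$), with usual polynomial operations; a monomial of $f$ is a term with $\alpha_{\mathbf{i}}\neq-\infty$; $f(\mathbf{a})$ denotes evaluation. A polynomial is constant if it has no monomial with $\mathbf{i}\ne 0$. *)

(* Defs.v *)
From HB Require Import structures.
From mathcomp Require Import all_boot all_order all_algebra.
From mathcomp Require Import finmap reals mpoly lra.

Set Implicit Arguments.
Unset Strict Implicit.
Unset Printing Implicit Defensive.

Import Order.TTheory GRing.Theory Num.Theory.
Local Open Scope ring_scope.

Variant trop (R : realType) : Type :=
  | NegInfty
  | Tangible of R
  | Ghost of R.

Arguments NegInfty {R}.
Arguments Tangible {R} a.
Arguments Ghost {R} a.

Section Trop.
Variable R : realType.
Implicit Types x y z : trop R.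

Definition trop_code x : option (R * bool) :=
  match x with
  | NegInfty => None
  | Tangible a => Some (a, false)
  | Ghost a => Some (a, true)
  end.

Definition trop_decode (o : option (R * bool)) : trop R :=
  match o with
  | None => NegInfty
  | Some (a, g) => if g then Ghost a else Tangible a
  end.

Lemma trop_codeK : cancel trop_code trop_decode.
Proof. by case. Qed.

HB.instance Definition _ := Choice.copy (trop R) (can_type trop_codeK).

Definition nu x : trop R :=
  match x with
  | NegInfty => NegInfty
  | Tangible a | Ghost a => Ghost a
  end.

Definition trop_lt x y : bool :=
  match x, y with
  | _, NegInfty => false
  | NegInfty, _ => true
  | Tangible a, Ghost b => a <= b
  | Tangible a, Tangible b | Ghost a, Tangible b | Ghost a, Ghost b => a < b
  end.

Definition trop_le x y : bool := (x == y) || trop_lt x y.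

Lemma trop_eqTT a b : (Tangible a == Tangible b :> trop R) = (a == b).
Proof. by apply/eqP/eqP => [[]|->]. Qed.

Lemma trop_eqGG a b : (Ghost a == Ghost b :> trop R) = (a == b).
Proof. by apply/eqP/eqP => [[]|->]. Qed.

Lemma trop_eqTG a b : (Tangible a == Ghost b :> trop R) = false.
Proof. exact/eqP. Qed.

Lemma trop_eqGT a b : (Ghost a == Tangible b :> trop R) = false.
Proof. exact/eqP. Qed.

Definition trop_eqE := (trop_eqTT, trop_eqGG, trop_eqTG, trop_eqGT).

Lemma trop_lt_irr : irreflexive trop_lt.
Proof. by case=> //= a; rewrite ltxx. Qed.

Lemma trop_lt_trans : transitive trop_lt.
Proof.
move=> [|b|b] [|a|a] [|c|c] //=; first [exact: lt_trans | exact: le_lt_trans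
  | exact: lt_le_trans | by move=> /ltW h /(le_trans h)
  | by move=> h /ltW /(le_trans h)].
Qed.

Lemma trop_lt_total x y : x != y -> trop_lt x y || trop_lt y x.
Proof.
by case: x y => [|a|a] [|b|b] //=; rewrite ?trop_eqE //; case: ltgtP.
Qed.

Fact trop_display : Order.disp_t. Proof. exact: Order.Disp tt tt. Qed.

HB.instance Definition _ := @Order.LtOrder.Build trop_display (trop R)
  trop_le trop_lt _ _ (fun _ _ => erefl) (fun _ _ => erefl) (fun _ _ => erefl)
  trop_lt_irr trop_lt_trans trop_lt_total.

Lemma trop_ltE x y : (x < y)%O = trop_lt x y.
Proof. by []. Qed.

Definition trop_add x y : trop R := if x == y then nu x else Order.max x y.

Definition trop_mul x y : trop R :=
  match x, y with
  | NegInfty, _ | _, NegInfty => NegInfty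
  | Tangible a, Tangible b => Tangible (a + b)
  | Tangible a, Ghost b | Ghost a, Tangible b | Ghost a, Ghost b =>
      Ghost (a + b)
  end.

Lemma trop_addC : commutative trop_add.
Proof.
move=> x y; rewrite /trop_add eq_sym; case: eqVneq => [-> //|_].
exact: maxC.
Qed.

Lemma trop_add0 : left_id NegInfty trop_add.
Proof. by case. Qed.

Lemma trop_addE :
  (forall a b, trop_add (Tangible a) (Tangible b) =
     if a < b then Tangible b else if b < a then Tangible a else Ghost a) *
  (forall a b, trop_add (Tangible a) (Ghost b) =
     if b < a then Tangible a else Ghost b) *
  (forall a b, trop_add (Ghost a) (Tangible b) =
     if a < b then Tangible b else Ghost a) *
  (forall a b, trop_add (Ghost a) (Ghost b) =
     if a < b then Ghost b else Ghost a).
Proof.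
by split; [split; [split|]|] => a b;
  rewrite /trop_add trop_eqE /Order.max ?trop_ltE /=; case: ltgtP.
Qed.

Lemma trop_addA : associative trop_add.
Proof.
have add0 x : trop_add x NegInfty = x by rewrite trop_addC trop_add0.
move=> [|a|a] [|b|b] [|c|c]; rewrite ?(trop_add0, add0) // ?trop_addE;
  repeat (rewrite ?trop_addE;
    match goal with |- context[Order.lt ?x ?y] => case: (ltgtP x y) => ? end);
  by [|exfalso; lra|congr Tangible; lra|congr Ghost; lra].
Qed.

Lemma trop_mulA : associative trop_mul.
Proof. by move=> [|a|a] [|b|b] [|c|c] //=; rewrite addrA. Qed.

Lemma trop_mulC : commutative trop_mul.
Proof. by move=> [|a|a] [|b|b] //=; rewrite addrC. Qed.

Lemma trop_mul1 : left_id (Tangible 0) trop_mul.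
Proof. by move=> [|a|a] //=; rewrite add0r. Qed.

Lemma trop_mul0 : left_zero NegInfty trop_mul.
Proof. by []. Qed.

Lemma trop_mulDl : left_distributive trop_mul trop_add.
Proof.
have add0 x : trop_add x NegInfty = x by rewrite trop_addC trop_add0.
have mul0 x : trop_mul x NegInfty = NegInfty by case: x.
move=> [|a|a] [|b|b] [|c|c]; rewrite ?(trop_add0, add0, mul0) //=;
  by rewrite !trop_addE ?ltrD2r; case: (ltgtP a b) => [||eab]; rewrite ?eab.
Qed.

Lemma trop_1neq0 : Tangible 0 != NegInfty :> trop R.
Proof. exact/eqP. Qed.

HB.instance Definition _ :=
  GRing.isNmodule.Build (trop R) trop_addA trop_addC trop_add0.

HB.instance Definition _ :=
  GRing.Nmodule_isComNzSemiRing.Build (trop R)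
    trop_mulA trop_mulC trop_mul1 trop_mulDl trop_mul0 trop_1neq0.

Definition ghost_or_zero : pred (trop R) :=
  fun x => match x with Tangible _ => false | _ => true end.

End Trop.

(* [{mpoly R[n]}] requires coefficients in a ring, whereas [trop R] is only a
   semiring: a formal polynomial is its finitely supported family of
   coefficients. The ring-scope 0, 1, +, *, ^+ on [trop R] are the tropical
   operations, so 0 is -oo and 1 is the real number 0. *)
Definition tpoly (R : realType) (n : nat) : Type :=
  {fsfun 'X_{1..n} -> trop R with (0 : trop R)}.

Definition teval (R : realType) (n : nat) (f : tpoly R n)
    (a : {ffun 'I_n -> trop R}) : trop R :=
  \sum_(m <- finsupp f) f m * \prod_(i < n) a i ^+ m i.

Definition tconstant (R : realType) (n : nat) (f : tpoly R n) : Prop :=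
  ~ exists2 m : 'X_{1..n}, m \in finsupp f & m != 0%MM.

Definition troot (R : realType) (n : nat) (f : tpoly R n)
    (a : {ffun 'I_n -> trop R}) : Prop :=
  teval f a \in @ghost_or_zero R.

(* Main.v *)
Require Import Defs.
From mathcomp Require Import all_boot all_order all_algebra.
From mathcomp Require Import finmap reals mpoly.

(** Evaluate at a point all of whose coordinates are the same ghost [t]: every
    nonconstant monomial then takes a ghost value, and for [t] large one of them
    absorbs the constant term. *)

Set Implicit Arguments.
Unset Strict Implicit.
Unset Printing Implicit Defensive.

Import Order.TTheory GRing.Theory Num.Theory.
Local Open Scope ring_scope.

Section GhostEvaluation.
Variable R : realType.
Implicit Types (x y : trop R) (a b t : R).

(** Ghosts together with -oo form an ideal, so at a constant ghost point only the constant term can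
    be tangible. A fixed nonconstant term becomes some [Ghost b], and [b] exceeds the constant
    coefficient once [t] is large; [ghost_add_le] absorbs that coefficient and [ghost_add_sum]
    handles the terms one at a time. *)

Lemma trop_plusE x y : x + y = trop_add x y. Proof. by []. Qed.

Lemma ghost_or_zeroD x y :
  ghost_or_zero x -> ghost_or_zero y -> ghost_or_zero (x + y).
Proof.
case: x y => [|a|a] [|b|b] // _ _; rewrite trop_plusE.
by rewrite trop_addE; case: ifP.
Qed.

Lemma ghost_or_zeroMr x y : ghost_or_zero y -> ghost_or_zero (x * y).
Proof. by case: x y => [|a|a] [|b|b]. Qed.

Lemma ghost_exprS t k : (Ghost t : trop R) ^+ k.+1 = Ghost (t *+ k.+1).
Proof. by elim: k => [|k IHk] //; rewrite exprS IHk [in RHS]mulrS. Qed.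

(* A ghost is additively idempotent, so adding it once to a sum amounts to
   adding it to every summand. *)
Lemma ghost_add_sum (I : eqType) (s : seq I) (F : I -> trop R) b :
  (forall i, i \in s -> ghost_or_zero (Ghost b + F i)) ->
  ghost_or_zero (Ghost b + \sum_(i <- s) F i).
Proof.
move=> ghostF; rewrite big_seq.
apply: (big_ind (fun x => ghost_or_zero (Ghost b + x))) => [|x y gx gy|//].
  by rewrite addr0.
have bb : Ghost b + Ghost b = Ghost b :> trop R.
  by rewrite trop_plusE trop_addE ltxx.
by rewrite -bb addrACA; exact: ghost_or_zeroD gx gy.
Qed.

(** The value at -oo is a harmless default: adding -oo leaves a ghost unchanged, and [mul_ghost]
    excludes it. *)
Definition trop_val x : R :=
  match x with NegInfty => 0 | Tangible a | Ghost a => a end.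

(** A weak inequality suffices because a ghost beats the tangible of equal value. *)
Lemma ghost_add_le b x : trop_val x <= b -> ghost_or_zero (Ghost b + x).
Proof.
by case: x => [|a|a] //= le_ab; rewrite trop_plusE trop_addE ?ltNge ?le_ab.
Qed.

Lemma mul_ghost x b : x != 0 -> x * Ghost b = Ghost (trop_val x + b).
Proof. by case: x. Qed.

End GhostEvaluation.

Theorem theorem2p5 (R : realType) (n : nat) (f : tpoly R n)
    (hf : ~ tconstant f) :
  exists a : {ffun 'I_n -> trop R}, troot f a.
Proof.
have [/hasP[m0 m0f m0N0]|noN0] := boolP (has (fun m => m != 0%MM) (finsupp f));
  last first.
  by case: hf => -[m mf mN0]; case/hasP: noN0; exists m.
(* The absolute value bounds the gap between the two coefficients and makes [t] nonnegative, so
   every multiple [t *+ k.+1] closes the gap too. *)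
pose t := `|trop_val (f 0%MM) - trop_val (f m0)|.
exists [ffun=> Ghost t]; rewrite /troot unfold_in /teval.
have termE m : f m * \prod_(i < n) [ffun=> Ghost t] i ^+ m i
    = f m * Ghost t ^+ mdeg m.
  by rewrite mdegE -prodrXr; congr (_ * _); apply: eq_bigr => i _; rewrite ffunE.
under eq_bigr do rewrite termE.
rewrite (big_fsetD1 m0) //=.
(* Positive degree matters: [Ghost t ^+ 0] is the tangible unit. *)
have : mdeg m0 != 0%N by rewrite mdeg_eq0.
case: (mdeg m0) => // k _.
rewrite ghost_exprS mul_ghost -?mem_finsupp //.
apply: ghost_add_sum => m _; have [->|mN0] := eqVneq m 0%MM.
  rewrite mdeg0 expr0 mulr1; apply: ghost_add_le.
  rewrite -lerBlDl (le_trans (ler_norm _)) // -/t mulrS lerDl.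
  by rewrite mulrn_wge0 // normr_ge0.
apply: ghost_or_zeroD => //; apply: ghost_or_zeroMr.
have : mdeg m != 0%N by rewrite mdeg_eq0.
by case: (mdeg m) => // j _; rewrite ghost_exprS.
Qed.
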